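(* Let $A(z)=a_3z^3+a_2z^2+a_1z+a_0$ and $B(z)=b_3z^3+b_2z^2+b_1z+b_0$ be polynomials with complex coefficients (of degree at most three), and let $w$ be a positive weight function on $[0,2\pi]$ satisfying $$\frac{d}{d\theta}\left[A(e^{i\theta})w(\theta)\right]=B(e^{i\theta})w(\theta),\qquad 0\le\theta\le 2\pi,$$ and $A(1)[w(2\pi)-w(0)]=0$. Then, for $n\ge3$, the associated monic orthogonal polynomials on the unit circle $\Phi_n$ and their reversed polynomials $\Phi_n^*$ satisfy $$zA(z)\Phi_n'(z)=U_n(z)\Phi_n(z)+V_n(z)\Phi_n^*(z),$$ $$-\widehat{A}(z)(\Phi_n^* )'(z)=W_n(z)\Phi_n(z)+Y_n(z)\Phi_n^*(z),$$ with $$\widehat{A}(z)=\overline{a}_0z^3+\overline{a}_1z^2+\overline{a}_2z+\overline{a}_3,$$ $$U_n(z)=na_3z^3+(\mathfrak{s}_{n,n+1}+na_3\overline{\alpha}_{n+1}\alpha_n)z^2+\mathfrak{s}_{n,n}z+ib_0+na_0,$$ $$V_n(z)=[ib_3-(n-2)a_3]\overline{\alpha}_nz^2-(\mathfrak{s}_{n,n+1}\overline{\alpha}_n+na_3\overline{\alpha}_{n+1}-\mathfrak{t}_{n,n})z+(ib_0+na_0)\overline{\alpha}_{n-1},$$ $$W_n(z)=(-i\overline{b}_0+n\overline{a}_0)\alpha_{n-1}z^2-(\overline{\mathfrak{s}}_{n,n+1}\alpha_n+n\overline{a}_3\alpha_{n+1}-\overline{\mathfrak{t}}_{n,n})z+\overline{\mathfrak{p}}_{n,n}-n\overline{a}_3\alpha_n,$$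 $$Y_n(z)=(-i\overline{b}_0)z^2+(\overline{\mathfrak{s}}_{n,n}-n\overline{a}_1)z+\overline{\mathfrak{s}}_{n,n+1}+n\overline{a}_3\alpha_{n+1}\overline{\alpha}_n-n\overline{a}_2,$$ where $$\mathfrak{p}_{n,n}=(ib_3+2a_3)\overline{\alpha}_n,\qquad \mathfrak{t}_{n,n}=(ib_3+a_3)\overline{\alpha}_{n+1}(1-|\alpha_n|^2)+(ib_2+a_2+a_3\ell_{n+1,n})\overline{\alpha}_n,$$ $$\mathfrak{s}_{n,n}=ib_1+(n+1)a_1-a_0\overline{\ell}_{n,n-1}-[ib_0+(n+1)a_0]\alpha_n\overline{\alpha}_{n-1},$$ $$\mathfrak{s}_{n,n+1}=na_2+a_3[(n-1)\ell_{n,n-1}-n\ell_{n+2,n+1}]+(ib_3+2a_3)\overline{\alpha}_n\alpha_{n-1}.$$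
   Context: Inner product: $\langle f,g\rangle=\int_0^{2\pi}f(e^{i\theta})\overline{g(e^{i\theta})}\,w(\theta)\,d\theta$. $\{\Phi_n\}_{n\ge0}$ is the sequence of monic orthogonal polynomials, $\deg\Phi_n=n$, $\langle\Phi_n,\Phi_m\rangle=0$ for $n\ne m$, written $\Phi_n(z)=z^n+\ell_{n,n-1}z^{n-1}+\cdots+\ell_{n,1}z+\ell_{n,0}$. The reversed polynomial is $\Phi_n^*(z)=z^n\overline{\Phi_n(1/\overline z)}$. Verblunsky coefficients: $\alpha_{n-1}=-\overline{\ell}_{n,0}=-\overline{\Phi_n(0)}$ for $n\ge1$, and $\alpha_{-1}=-1$. Prime denotes $d/dz$. The Pearson equation is understood with $\theta\mapsto A(e^{i\theta})w(\theta)$ absolutely continuous on $[0,2\pi]$ and the equation holding almost everywhere; $A(1)[w(2\pi)-w(0)]$ denotes the difference of the boundary values of $A(e^{i\theta})w(\theta)$ at $2\pi$ and $0$. *)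

(* Defs.v *)
From HB Require Import structures.
From mathcomp Require Import all_boot all_order all_algebra.
From mathcomp Require Import complex.
From mathcomp Require Import all_classical all_reals all_analysis.
Import Order.TTheory GRing.Theory Num.Theory.
Import numFieldNormedType.Exports.

Set Implicit Arguments.
Unset Strict Implicit.
Unset Printing Implicit Defensive.

Local Open Scope classical_set_scope.
Local Open Scope complex_scope.
Local Open Scope ring_scope.

(* ['i%C] and [_^*%C] are the imaginary unit and conjugation of [complex.v]. *)

Definition expi (R : realType) (t : R) : R[i] := (cos t +i* sin t)%C.

(* [R[i]] carries no normed-module structure over [R] in the library, so
   derivatives and integrals of functions [R -> R[i]] are taken componentwise. *)

Definition is_cderive (R : realType) (F : R -> R[i]) (t : R) (l : R[i]) : Prop :=
  is_derive t (1 : R) (fun u => complex.Re (F u)) (complex.Re l) /\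
  is_derive t (1 : R) (fun u => complex.Im (F u)) (complex.Im l).

Definition cintegral (R : realType) (D : set R) (F : R -> R[i]) : R[i] :=
  ((\int[@lebesgue_measure R]_(t in D) complex.Re (F t))%R +i*
   (\int[@lebesgue_measure R]_(t in D) complex.Im (F t))%R)%C.

(* Absolute continuity on [a, b]; degenerate intervals (s i = t i) are harmless.
   The norm of [R[i]] takes its values in [R[i]], whence [e%:C]. *)
Definition cabs_continuous (R : realType) (a b : R) (F : R -> R[i]) : Prop :=
  forall e : R, 0 < e -> exists2 d : R, 0 < d &
    forall (k : nat) (s t : 'I_k -> R),
      (forall i, [/\ a <= s i, s i <= t i & t i <= b]) ->
      trivIset setT (fun i => `]s i, t i[%classic) ->
      \sum_(i < k) (t i - s i) < d ->
      \sum_(i < k) `|F (t i) - F (s i)| < (e%:C)%C.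

(* Integrability is what makes the inner product below meaningful on
   polynomials; positivity is only required almost everywhere. *)
Definition positive_weight (R : realType) (w : R -> R) : Prop :=
  (@lebesgue_measure R).-integrable `[0, 2 * pi]%classic (EFin \o w) /\
  {ae @lebesgue_measure R, forall t, t \in `[0, 2 * pi] -> 0 < w t}.

Definition inner (R : realType) (w : R -> R) (f g : R[i] -> R[i]) : R[i] :=
  cintegral `[0, 2 * pi]%classic
    (fun t => f (expi t) * (g (expi t))^*%C * ((w t)%:C)%C).

Definition monic_orthogonal (R : realType) (w : R -> R)
    (Phi : nat -> {poly R[i]}) : Prop :=
  [/\ forall n, size (Phi n) = n.+1,
      forall n, Phi n \is monic
    & forall n m, n != m -> inner w (horner (Phi n)) (horner (Phi m)) = 0].

(* d/dtheta [A(e^{i theta}) w(theta)] = B(e^{i theta}) w(theta) on [0, 2 pi]. *)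
Definition pearson (R : realType) (A B : {poly R[i]}) (w : R -> R) : Prop :=
  let F := fun t : R => A.[expi t] * ((w t)%:C)%C in
  cabs_continuous 0 (2 * pi) F /\
  {ae @lebesgue_measure R, forall t, t \in `[0, 2 * pi] ->
    is_cderive F t (B.[expi t] * ((w t)%:C)%C)}.

(* z^n * conj (p (1 / conj z)) as a polynomial, for p of degree at most n;
   see [horner_reversed]. *)
Definition reversed (R : realType) (n : nat) (p : {poly R[i]}) : {poly R[i]} :=
  \poly_(i < n.+1) (p`_(n - i))^*%C.

Lemma horner_reversed (R : realType) (n : nat) (p : {poly R[i]}) (z : R[i]) :
  (size p <= n.+1)%N -> z != 0 ->
  (reversed n p).[z] = z ^+ n * (p.[(z^*%C)^-1])^*%C.
Proof.
move=> sp z0; rewrite horner_poly (horner_coef_wide _ sp) rmorph_sum /=.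
rewrite mulr_sumr (reindex_inj rev_ord_inj) /=; apply: eq_bigr => i _.
have ilen : (i <= n)%N by rewrite -ltnS.
rewrite subSS subKn // rmorphM rmorphXn /= conjc_inv conjcK mulrCA.
by rewrite exprVn -expfB_cond // (negbTE z0).
Qed.

Definition ell (R : realType) (Phi : nat -> {poly R[i]}) (n k : nat) : R[i] :=
  (Phi n)`_k.

(* alpha_n = - conj (Phi_{n+1}(0)) for n >= 0; the index -1, where the same
   formula gives alpha_{-1} = -1, is left out, so that [n.-1] below is only
   meaningful for n >= 1. *)
Definition verblunsky (R : realType) (Phi : nat -> {poly R[i]}) (n : nat) : R[i] :=
  - ((Phi n.+1).[0])^*%C.

Section Coefficients.
Context {R : realType}.
Implicit Types (A B : {poly R[i]}) (Phi : nat -> {poly R[i]}) (n : nat) (z : R[i]).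

Definition Ahat A z : R[i] :=
  (A`_0)^*%C * z ^+ 3 + (A`_1)^*%C * z ^+ 2 + (A`_2)^*%C * z + (A`_3)^*%C.

(* p_{n,n}, t_{n,n}, s_{n,n} and s_{n,n+1} *)

Definition coef_p A B Phi n : R[i] :=
  let alpha := verblunsky Phi in
  ('i%C * B`_3 + 2 * A`_3) * (alpha n)^*%C.

Definition coef_t A B Phi n : R[i] :=
  let alpha := verblunsky Phi in
  ('i%C * B`_3 + A`_3) * (alpha n.+1)^*%C * (1 - `|alpha n| ^+ 2)
  + ('i%C * B`_2 + A`_2 + A`_3 * ell Phi n.+1 n) * (alpha n)^*%C.

Definition coef_s A B Phi n : R[i] :=
  let alpha := verblunsky Phi in
  'i%C * B`_1 + n.+1%:R * A`_1 - A`_0 * (ell Phi n n.-1)^*%C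
  - ('i%C * B`_0 + n.+1%:R * A`_0) * alpha n * (alpha n.-1)^*%C.

Definition coef_s' A B Phi n : R[i] :=
  let alpha := verblunsky Phi in
  n%:R * A`_2
  + A`_3 * ((n%:R - 1) * ell Phi n n.-1 - n%:R * ell Phi n.+2 n.+1)
  + ('i%C * B`_3 + 2 * A`_3) * (alpha n)^*%C * alpha n.-1.

Definition Ufun A B Phi n z : R[i] :=
  let alpha := verblunsky Phi in
  n%:R * A`_3 * z ^+ 3
  + (coef_s' A B Phi n + n%:R * A`_3 * (alpha n.+1)^*%C * alpha n) * z ^+ 2
  + coef_s A B Phi n * z
  + 'i%C * B`_0 + n%:R * A`_0.

Definition Vfun A B Phi n z : R[i] :=
  let alpha := verblunsky Phi in
  ('i%C * B`_3 - (n%:R - 2) * A`_3) * (alpha n)^*%C * z ^+ 2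
  - (coef_s' A B Phi n * (alpha n)^*%C + n%:R * A`_3 * (alpha n.+1)^*%C
     - coef_t A B Phi n) * z
  + ('i%C * B`_0 + n%:R * A`_0) * (alpha n.-1)^*%C.

Definition Wfun A B Phi n z : R[i] :=
  let alpha := verblunsky Phi in
  (- 'i%C * (B`_0)^*%C + n%:R * (A`_0)^*%C) * alpha n.-1 * z ^+ 2
  - ((coef_s' A B Phi n)^*%C * alpha n + n%:R * (A`_3)^*%C * alpha n.+1
     - (coef_t A B Phi n)^*%C) * z
  + (coef_p A B Phi n)^*%C - n%:R * (A`_3)^*%C * alpha n.

Definition Yfun A B Phi n z : R[i] :=
  let alpha := verblunsky Phi in
  - 'i%C * (B`_0)^*%C * z ^+ 2
  + ((coef_s A B Phi n)^*%C - n%:R * (A`_1)^*%C) * z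
  + (coef_s' A B Phi n)^*%C + n%:R * (A`_3)^*%C * alpha n.+1 * (alpha n)^*%C
  - n%:R * (A`_2)^*%C.

End Coefficients.

(* Main.v *)
(** Integrating the Pearson equation against [e^{ikt}] over a period turns it
    into the moment recurrence [sum_j (i k a_j + b_j) m_{k+j} = 0] for all
    integers [k], where [m_k] is the integral of [e^{ikt} w(t)]; hence
    [<z A Phi_n', z^k> = sum_j (k a_j + i b_j) <Phi_n, z^{k-j}>].  In the
    difference of the two sides of the first identity the constant coefficient
    and those of degree [n+2], [n+3] vanish, and so do the inner products with
    [z, ..., z^{n+1}]; such a polynomial is [z] times a polynomial of degree at
    most [n] orthogonal to all polynomials of degree at most [n], hence zero.
    The second identity is the reversal of the first.  The boundary term of the
    integration vanishes by the fundamental theorem of calculus for absolutely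
    continuous functions. *)
Require Import Defs.
From HB Require Import structures.
From mathcomp Require Import all_boot all_order all_algebra.
From mathcomp Require Import complex.
From mathcomp Require Import all_classical all_reals all_analysis.
From mathcomp Require Import measurable_realfun.
From mathcomp Require Import ring lra zify.
Import Order.TTheory GRing.Theory Num.Theory.
Import numFieldNormedType.Exports.

Set Implicit Arguments.
Unset Strict Implicit.
Unset Printing Implicit Defensive.

(** * Absolutely continuous functions *)

Section AbsoluteContinuity.
Local Open Scope classical_set_scope.
Local Open Scope ring_scope.
Context {R : realType}.
Implicit Types (f g : R -> R) (a b : R).
Local Notation mu := (@lebesgue_measure R).

Definition abs_continuous a b f : Prop :=
  forall e : R, 0 < e -> exists2 d : R, 0 < d &
    forall (k : nat) (s t : 'I_k -> R),
      (forall i, [/\ a <= s i, s i <= t i & t i <= b]) ->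
      trivIset setT (fun i => `]s i, t i[%classic) ->
      \sum_(i < k) (t i - s i) < d ->
      \sum_(i < k) `|f (t i) - f (s i)| < e.

(** The non-strict bound covers [c] itself, which the difference quotient leaves out. *)
Lemma derive0_near f c e : is_derive c (1 : R) f 0 -> 0 < e ->
  exists2 r, 0 < r & forall x, `|x - c| < r -> `|f x - f c| <= e * `|x - c|.
Proof.
move=> [df Df] e0.
have /cvgrPdist_lt/(_ _ e0) :
    h^-1 *: (f (h *: 1 + c) - f c) @[h --> 0^'] --> 'D_1 f c by exact: df.
rewrite Df => -[r /= r0 H]; exists r => // x xcr.
have [->|xc] := eqVneq x c; first by rewrite !subrr !normr0 mulr0.
have xc0 : x - c != 0 by rewrite subr_eq0.
have := H (x - c); rewrite /= sub0r normrN => /(_ xcr xc0).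
rewrite sub0r normrN normrM normfV /GRing.scale /= mulr1 subrK.
by rewrite mulrC ltr_pdivrMr ?normr_gt0// => /ltW.
Qed.

(** Outer regularity only bounds the measure of [U] minus [M]; as [M] is null, this is the measure
    of [U]. *)
Lemma negligible_open_cover (N : set R) (d : R) : mu.-negligible N -> 0 < d ->
  exists U : set R, [/\ open U, N `<=` U & (mu U < d%:E)%E].
Proof.
move=> [M [mM M0 NM]] d0.
have Moo : (mu M < +oo)%E by rewrite M0 ltry.
have [U [oU MU Ud]] := lebesgue_regularity_outer mM Moo d0.
exists U; split => //; first exact: subset_trans MU.
have mU : measurable U by exact: open_measurable.
rewrite -(setDUK MU) setUC measureU0//; exact: measurableD.
Qed.

Lemma lebesgue_measure_bigsetU_itvoo k (s t : 'I_k -> R) :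
  (forall i, s i <= t i) -> trivIset setT (fun i => `]s i, t i[%classic) ->
  mu (\big[setU/set0]_(i < k) `]s i, t i[%classic) =
    (\sum_(i < k) (t i - s i))%:E.
Proof.
move=> st tst; rewrite -sumEFin (@measure_bigsetU_ord _ _ _ mu k xpredT)//.
apply: eq_bigr => i _; rewrite /= lebesgue_measure_itv/= lte_fin.
case: ltP => // tsi.
by rewrite (_ : s i = t i) ?subrr//; apply/eqP; rewrite eq_le st.
Qed.

(* Continuous induction replaces Vitali's covering theorem: intervals around
   points of zero derivative contribute at most [e * length], the others are
   collected in a finite family contained in an open set of small measure. *)
Lemma abs_continuous_derive0 f a b : a <= b -> abs_continuous a b f ->
  {ae mu, forall t, t \in `[a, b] -> is_derive t (1 : R) f 0} -> f b = f a.
Proof.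
move=> ab acf f'0.
suff H e : 0 < e -> `|f b - f a| <= e * (b - a) + e.
  apply/eqP; rewrite -subr_eq0 -normr_le0; apply/ler_addgt0Pr => e e0.
  have ba : 0 < b - a + 1 by rewrite ltr_wpDl// subr_ge0.
  (* With $e'=e/(b-a+1)$ the bound $e'(b-a)+e'$ is exactly $e$. *)
  have := H (e / (b - a + 1)) (divr_gt0 e0 ba).
  by rewrite add0r -[X in _ <= _ + X]mulr1 -mulrDr divfK ?gt_eqF.
move=> e0; have [d d0 acd] := acf _ e0.
have [U [oU NU Ud]] := negligible_open_cover f'0 d0.
(* Invariant of the continuous induction. Since the intervals are ordered from left to right, a new
   one can be appended at the right end, and disjointness follows. *)
pose good x := exists k (s t : nat -> R), [/\
  forall i, (i < k)%N ->
    [/\ a <= s i, s i <= t i, t i <= x & `]s i, t i[ `<=` U],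
  forall i j, (i < j < k)%N -> t i <= s j &
  `|f x - f a| <= e * (x - a) + \sum_(i < k) `|f (t i) - f (s i)|].
have step c : a <= c <= b -> exists2 r, 0 < r & forall x y,
    a <= x -> c - r < x -> x <= c -> c <= y -> y < c + r -> good x -> good y.
  (* If [c] lies in [U], the interval from [x] to [y] joins the family. Otherwise the derivative at
     [c] is zero, and the increments from [x] to [c] and from [c] to [y] cost at most [e] times
     their lengths. *)
  move=> cab; have [Uc|nUc] := pselect (U c).
    have [r /= r0 crU] := oU _ Uc.
    exists r => // x y ax crx xc cy ycr [k [s [t [st ts fx]]]].
    exists k.+1, (fun i => if (i < k)%N then s i else x),
      (fun i => if (i < k)%N then t i else y); split.
    - move=> i; rewrite ltnS leq_eqVlt => /predU1P[->|ik].
        rewrite ltnn; split => //; first exact: le_trans cy.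
        move=> z /=; rewrite in_itv/= => /andP[xz zy]; apply: crU.
        by rewrite /ball/= ltr_norml; apply/andP; split; lra.
      rewrite ik; have [asi sti tix stiU] := st _ ik.
      by split => //; apply: le_trans tix _; apply: le_trans cy.
    - move=> i j /andP[ij]; rewrite ltnS leq_eqVlt => /predU1P[jk|jk].
        by rewrite jk ltnn -jk ij; case: (st i) => //; rewrite -jk.
      by rewrite jk (ltn_trans ij jk); apply: ts; rewrite ij jk.
    - rewrite big_ord_recr/= ltnn.
      under eq_bigr => i _ do rewrite ltn_ord.
      rewrite (_ : f y - f a = (f x - f a) + (f y - f x)); last by ring.
      apply: le_trans (ler_normD _ _) _; rewrite addrA lerD2r.
      apply: le_trans fx _; rewrite lerD2r ler_pM2l// lerD2r.
      exact: le_trans cy.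
  have f'c : is_derive c (1 : R) f 0.
    apply: contrapT => nfc; apply/nUc/NU => /= H; apply: nfc; apply: H.
    by rewrite in_itv.
  have [r r0 fr] := derive0_near f'c e0.
  exists r => // x y ax crx xc cy ycr [k [s [t [st ts fx]]]].
  exists k, s, t; split => //.
    move=> i /st[asi sti tix stiU]; split => //.
    by apply: le_trans tix _; apply: le_trans cy.
  have /fr : `|x - c| < r by rewrite distrC ger0_norm ?subr_ge0//; lra.
  have /fr : `|y - c| < r by rewrite ger0_norm ?subr_ge0//; lra.
  rewrite (distrC x) (@ger0_norm _ (y - c)) ?(@ger0_norm _ (c - x)) ?subr_ge0//.
  move=> fyc fxc.
  rewrite (_ : f y - f a = f y - f c - (f x - f c) + (f x - f a)); last by ring.
  apply: le_trans (ler_normD _ _) _.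
  have := ler_normB (f y - f c) (f x - f c).
  move: fyc fxc fx; rewrite !mulrBr; lra.
have gooda : good a.
  exists 0%N, (fun=> a), (fun=> a); split => //.
  by rewrite big_ord0 !subrr normr0 mulr0 addr0.
(* By [step] at [sup S], goodness passes from a point of [S] near the supremum to the points just
   above it. So [b] is reached, or else [S] would have a point beyond its supremum. *)
pose S := [set x | a <= x <= b /\ good x].
have supS : has_sup S.
  split; first by exists a; split => //; rewrite lexx.
  by exists b => x [/andP[]].
have cab : a <= sup S <= b.
  apply/andP; split; last by apply: ge_sup (proj1 supS) _ => x [/andP[]].
  by apply: (ub_le_sup (proj2 supS)); split => //; rewrite lexx.
have [r r0 H] := step _ cab.
have [x [/andP[ax xb] gx] cx] := sup_adherent r0 supS.
have xc : x <= sup S.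
  by apply: (ub_le_sup (proj2 supS)); split => //; rewrite ax.
have gb : good b.
  have gy y : sup S <= y -> y < sup S + r -> good y.
    by move=> cy yr; exact: (H x y).
  have [bc|cb] := leP b (sup S).
    have -> : b = sup S by apply/eqP; rewrite eq_le bc; case/andP: cab.
    by apply: gy => //; rewrite ltrDl.
  have [br|rb] := ltP b (sup S + r); first by apply: gy => //; exact: ltW.
  have : S (sup S + r / 2).
    have r20 : 0 < r / 2 by exact: divr_gt0.
    split; last by apply: gy; lra.
    by case/andP: cab => ? _; apply/andP; split; lra.
  by move/(ub_le_sup (proj2 supS)); lra.
have [k [s [t [st ts fb]]]] := gb.
have tst : trivIset setT (fun i : 'I_k => `]s i, t i[%classic).
  apply/trivIsetP => /= i j _ _ ij; wlog {ij} : i j / (i < j)%N.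
    move=> W; move: ij; rewrite -val_eqE neq_ltn => /orP[/W//|/W].
    by rewrite setIC.
  move=> ij; apply/seteqP; split => z //= -[]; rewrite !in_itv/= => /andP[_ zt].
  by move=> /andP[sz _]; have := ts i j; rewrite ij ltn_ord => /(_ isT); lra.
(* The intervals are disjoint and lie in [U], so their total length is below [d] and the remaining
   sum is below [e]. *)
apply: le_trans fb _; rewrite lerD2l; apply/ltW/acd => //.
  by move=> i; have [] := st i (ltn_ord i).
rewrite -lte_fin -lebesgue_measure_bigsetU_itvoo//; last first.
  by move=> i; have [] := st i (ltn_ord i).
apply: le_lt_trans Ud; apply: le_measure; rewrite ?inE.
- by apply: bigsetU_measurable => i _; exact: measurable_itv.
- exact: open_measurable.
- elim/big_ind: _ => [|V W VU WU|i _] //; first by rewrite subUset; split.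
  by case: (st i).
Qed.

(** Absolute continuity for a family of one interval. *)
Lemma abs_continuous_uniform a b f e : abs_continuous a b f -> 0 < e ->
  exists2 d, 0 < d & forall x y, x \in `[a, b] -> y \in `[a, b] ->
    `|x - y| < d -> `|f x - f y| < e.
Proof.
move=> acf e0; have [d d0 acd] := acf _ e0; exists d => //.
have W x y : x \in `[a, b] -> y \in `[a, b] -> x <= y -> y - x < d ->
    `|f y - f x| < e.
  rewrite !in_itv/= => /andP[ax _] /andP[_ yb] xy yxd.
  have := acd 1%N (fun=> x) (fun=> y); rewrite !big_ord1; apply => //.
  by apply/trivIsetP => i j _ _; rewrite !ord1 eqxx.
move=> x y xab yab; have [xy|/ltW yx] := leP x y.
  by rewrite distrC (distrC (f x)) ger0_norm ?subr_ge0//; exact: W.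
by rewrite ger0_norm ?subr_ge0//; exact: W.
Qed.

Lemma abs_continuous_continuous a b f : abs_continuous a b f ->
  {within `[a, b], continuous f}.
Proof.
move=> acf; apply/subspace_continuousP => x xab; apply/cvgrPdist_lt => e e0.
have [d d0 fd] := abs_continuous_uniform acf e0.
exists d => // y /= xyd yab; exact: fd.
Qed.

Lemma abs_continuous_bounded a b f : a <= b -> abs_continuous a b f ->
  exists2 M, 0 < M & forall x, x \in `[a, b] -> `|f x| <= M.
Proof.
move=> ab /abs_continuous_continuous cf.
have [c _ fc] := EVT_max ab cf; have [c' _ fc'] := EVT_min ab cf.
exists (`|f c| + `|f c'| + 1) => [|x xab]; first by rewrite ltr_wpDl// addr_ge0.
have := ler_norm (f c); have := ler_norm (- f c'); rewrite normrN.
have := fc _ xab; have := fc' _ xab; have := normr_ge0 (f c).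
have := normr_ge0 (f c'); rewrite ler_norml => *; apply/andP; split; lra.
Qed.

Lemma abs_continuousD a b f g : abs_continuous a b f -> abs_continuous a b g ->
  abs_continuous a b (f \+ g).
Proof.
move=> acf acg e e0; have e20 : 0 < e / 2 by exact: divr_gt0.
have [d d0 fd] := acf _ e20; have [d' d'0 gd] := acg _ e20.
exists (Num.min d d'); first by rewrite lt_min d0.
move=> k s t st tst; rewrite lt_min => /andP[/(fd _ _ _ st tst) sf].
move=> /(gd _ _ _ st tst) sg; rewrite [ltRHS]splitr.
apply: le_lt_trans (ltrD sf sg).
rewrite -big_split/=; apply: ler_sum => i _.
by rewrite /= opprD addrACA ler_normD.
Qed.

Lemma abs_continuousN a b f : abs_continuous a b f -> abs_continuous a b (\- f).
Proof.
move=> acf e /acf[d d0 fd]; exists d => // k s t st tst /(fd _ _ _ st tst).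
by congr (_ < _); apply: eq_bigr => i _; rewrite /= -opprD normrN.
Qed.

(** Both factors are bounded on the compact interval, so an increment of the product is controlled
    by the increments of the factors. *)
Lemma abs_continuousM a b f g : a <= b -> abs_continuous a b f ->
  abs_continuous a b g -> abs_continuous a b (f \* g).
Proof.
move=> ab acf acg e e0.
have [M M0 fM] := abs_continuous_bounded ab acf.
have [N N0 gN] := abs_continuous_bounded ab acg.
have eN0 : 0 < e / 2 / N by rewrite !divr_gt0.
have eM0 : 0 < e / 2 / M by rewrite !divr_gt0.
have [d d0 fd] := acf _ eN0; have [d' d'0 gd] := acg _ eM0.
exists (Num.min d d'); first by rewrite lt_min d0.
move=> k s t st tst; rewrite lt_min => /andP[/(fd _ _ _ st tst) sf].
move=> /(gd _ _ _ st tst) sg; rewrite [ltRHS]splitr.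
rewrite ltr_pdivlMr// mulr_suml in sf; rewrite ltr_pdivlMr// mulr_suml in sg.
apply: le_lt_trans (ltrD sf sg); rewrite -big_split/=.
apply: ler_sum => i _; have [asi sti tib] := st i.
rewrite (_ : f (t i) * g (t i) - f (s i) * g (s i) =
  (f (t i) - f (s i)) * g (t i) + (g (t i) - g (s i)) * f (s i)); last by ring.
apply: le_trans (ler_normD _ _) _; rewrite !normrM.
apply: lerD; apply: ler_wpM2l => //; [apply: gN|apply: fM]; rewrite in_itv/=.
- by rewrite tib andbT (le_trans asi).
- by rewrite asi (le_trans sti).
Qed.

Lemma abs_continuous_lipschitz a b f K :
  (forall x y, `|f x - f y| <= K * `|x - y|) -> abs_continuous a b f.
Proof.
move=> fK e e0.
have K0 : 0 <= K by have := fK 1 0; rewrite subr0 normr1 mulr1; exact: le_trans.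
(* [K] may be zero, so the division is by [K + 1]. *)
have K10 : 0 < K + 1 by rewrite ltr_wpDl.
exists (e / (K + 1)) => [|k s t st _]; first exact: divr_gt0.
rewrite ltr_pdivlMr// mulr_suml; apply: le_lt_trans.
apply: ler_sum => i _; have [_ sti _] := st i.
apply: le_trans (fK _ _) _; rewrite mulrC ger0_norm ?subr_ge0//.
by rewrite ler_wpM2l ?subr_ge0// lerDl.
Qed.

(** The increments over the family sum to at most the integral of $|g|$ over its union, which is
    small when the measure of the union is. *)
Lemma abs_continuous_integral a b g : mu.-integrable setT (EFin \o g) ->
  abs_continuous a b (fun x => \int[mu]_(t in `]-oo, x]) g t)%R.
Proof.
move=> ig e e0; have [d [d0 H]] := integral_normr_continuous ig e0.
exists d => // k s t st tst std.
have ign (D : set R) :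
    measurable D -> mu.-integrable D (EFin \o (fun x => `|g x|)).
  by move=> mD; apply: integrableS (integrable_norm ig).
pose D := \big[setU/set0]_(i < k) `]s i, t i[%classic.
have mD : measurable D.
  by apply: bigsetU_measurable => i _; exact: measurable_itv.
have muD : mu D = (\sum_(i < k) (t i - s i))%:E.
  by apply: lebesgue_measure_bigsetU_itvoo => // i; case: (st i).
apply: le_lt_trans (H D mD _); last by move: std; rewrite -lte_fin -muD.
rewrite -lee_fin /Rintegral fineK; last first.
  by apply: integrable_fin_num => //; exact: ign.
rewrite /D integral_bigsetU_EFin//=; last 3 first.
- exact: index_enum_uniq.
- exact: sub_trivIset tst.
- by apply: measurable_int (ign _ _).
rewrite -sumEFin; apply: lee_sum => i _; have [_ sti _] := st i.
rewrite Rintegral_itvB//; last first.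
  exact: integrableS ig.
apply: (@le_trans _ _ (\int[mu]_(x in `]s i, t i]) `|g x|)%R%:E).
  rewrite lee_fin; apply: le_normr_Rintegral => //; exact: integrableS ig.
rewrite -Rintegral_itv_bndo_bndc; last exact: ign.
rewrite /Rintegral fineK//; apply: integrable_fin_num => //; exact: ign.
Qed.

(** By Lebesgue differentiation, [f] minus the indefinite integral of [g] has zero derivative almost
    everywhere; being absolutely continuous, it takes equal values at [a] and [b]. *)
Lemma abs_continuous_FTC a b f g : a <= b -> abs_continuous a b f ->
  mu.-integrable `[a, b] (EFin \o g) ->
  {ae mu, forall t, t \in `[a, b] -> is_derive t (1 : R) f (g t)} ->
  (\int[mu]_(t in `[a, b]) g t)%R = f b - f a.
Proof.
(* Extension by zero gives a function integrable on the whole line, so that it can be integrated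
   from minus infinity. *)
move=> ab acf ig fg; pose h := g \_ `[a, b].
have ih : mu.-integrable setT (EFin \o h).
  by rewrite -restrict_EFin; apply/integrable_restrict => //; rewrite setTI.
pose H x := (\int[mu]_(t in `]-oo, x]) h t)%R.
have H' : {ae mu, forall x, derivable H x 1 /\ derive1 H x = h x}.
  apply: FTC1Ny; first by move=> y; exact: integrableS ih.
  exact: integrable_locally.
have : (f \- H) b = (f \- H) a.
  apply: abs_continuous_derive0 (ab) _ _.
    exact/abs_continuousD/abs_continuousN/abs_continuous_integral.
  have aeF : Filter (nbhs (almost_everywhere mu)).
    exact: ae_filter_ringOfSetsType.
  apply: filterS2 H' fg => t [dH H't] fg tab.
  have -> : 0 = g t - h t by rewrite /h patchE mem_set// subrr.
  have ? := fg tab.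
  have ? : is_derive t (1 : R) H (h t).
    by split => //; rewrite -H't derive1E.
  exact: is_deriveB.
have Hab : H b - H a = \int[mu]_(t in `[a, b]) g t.
  rewrite /H Rintegral_itvB//; last exact: integrableS ih.
  rewrite Rintegral_itv_obnd_cbnd; last exact: integrableS ih.
  by apply: eq_Rintegral => t tab; rewrite /h patchE tab.
by rewrite -Hab /=; lra.
Qed.

Lemma lipschitz_derive f df K : (forall x, is_derive x (1 : R) f (df x)) ->
  (forall x, `|df x| <= K) -> forall x y, `|f x - f y| <= K * `|x - y|.
Proof.
move=> fdf dfK x y; wlog xy : x y / y <= x.
  by move=> W; have [/W//|/ltW/W] := leP y x; rewrite distrC (distrC y).
have cf : {within `[y, x], continuous f}.
  apply: continuous_subspaceT => z.
  exact/differentiable_continuous/derivable1_diffP.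
have [c _ ->] := MVT_segment xy (fun z _ => fdf z) cf.
by rewrite normrM ler_wpM2r.
Qed.

End AbsoluteContinuity.

(** * Orthogonal polynomials from moments *)

Section Moments.
Local Open Scope ring_scope.
Context {R : realType}.
Local Notation C := R[i].
Variable m : int -> C.
Implicit Types (p q : {poly C}) (k : int).

(* With m k the integral of e^{ikt} against the weight, this is <p, z^k>. *)
Definition moment k p : C := \sum_(i < size p) p`_i * m (i%:Z - k).

Lemma moment_wide n p k : (size p <= n)%N ->
  moment k p = \sum_(i < n) p`_i * m (i%:Z - k).
Proof.
move=> pn; rewrite /moment (big_ord_widen _ (fun i => p`_i * m (i%:Z - k)) pn).
rewrite big_mkcond; apply: eq_bigr => i _; case: ltnP => // /(nth_default 0) ->.
by rewrite mul0r.
Qed.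

Lemma moment_is_linear k : linear_for *%R (moment k).
Proof.
move=> a p q; pose n := maxn (size p) (size q).
rewrite !(@moment_wide n) ?leq_maxl ?leq_maxr//; last first.
  apply: leq_trans (size_polyD _ _) _.
  by rewrite geq_max leq_maxr andbT (leq_trans (size_scale_leq _ _)) ?leq_maxl.
rewrite mulr_sumr -big_split/=; apply: eq_bigr => i _.
by rewrite coefD coefZ mulrDl mulrA.
Qed.

HB.instance Definition _ k :=
  GRing.isLinear.Build C {poly C} C _ (moment k) (@moment_is_linear k).

Lemma momentD p q k : moment k (p + q) = moment k p + moment k q.
Proof. exact: (raddfD (moment k)). Qed.

Lemma momentB p q k : moment k (p - q) = moment k p - moment k q.
Proof. exact: (raddfB (moment k)). Qed.

Lemma momentZ a p k : moment k (a *: p) = a * moment k p.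
Proof. exact: (scalarZ (moment k)). Qed.

Lemma momentXM p k : moment k ('X * p) = moment (k - 1) p.
Proof.
have [->|p0] := eqVneq p 0; first by rewrite mulr0 !(raddf0 (moment _)).
rewrite mulrC /moment size_mulX// big_ord_recl coefMX eqxx mul0r add0r.
by apply: eq_bigr => i _; rewrite coefMX/= /bump/=; congr (_ * m _); lia.
Qed.

Lemma momentXnM n p k : moment k ('X^n * p) = moment (k - n%:Z) p.
Proof.
elim: n k => [|n IHn] k; first by rewrite expr0 mul1r subr0.
by rewrite exprS -mulrA momentXM IHn; congr (moment _ _); lia.
Qed.

Hypothesis m_conj : forall k, (m k)^*%C = m (- k).

(** Reversal moves the conjugate of the coefficient of $z^i$ to $z^{n-i}$; with
    $\overline{m_k}=m_{-k}$ this reflects the index [k] to $n-k$. *)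
Lemma moment_reversed n p k : (size p <= n.+1)%N ->
  moment k (reversed n p) = (moment (n%:Z - k) p)^*%C.
Proof.
move=> pn; rewrite !(@moment_wide n.+1) ?size_poly// rmorph_sum.
rewrite [RHS](reindex_inj rev_ord_inj); apply: eq_bigr => i _ /=.
rewrite coef_poly ltn_ord rmorphM /= m_conj subSS; congr (_ * m _).
by have := ltn_ord i; lia.
Qed.

End Moments.

Lemma size_reversed (R : realType) n (p : {poly R[i]}) :
  (size (reversed n p) <= n.+1)%N.
Proof. exact: size_poly. Qed.

Lemma coef_reversed (R : realType) n (p : {poly R[i]}) k :
  ((reversed n p)`_k = if (k <= n)%N then (p`_(n - k))^*%C else 0)%R.
Proof. by rewrite coef_poly ltnS. Qed.

Lemma coefX_deriv (R : nzRingType) (p : {poly R}) k :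
  (('X * p^`())`_k = k%:R * p`_k)%R.
Proof.
by rewrite coefXM; case: k => [|k] /=; rewrite ?mul0r// coef_deriv mulr_natl.
Qed.

(** * Szego recurrence and moments of the monic orthogonal polynomials *)

Section MonicOrthogonal.
Local Open Scope ring_scope.
Context {R : realType}.
Local Notation C := R[i].
Variables (m : int -> C) (Phi : nat -> {poly C}).
Implicit Types (p q : {poly C}).
Hypothesis m_conj : forall k, (m k)^*%C = m (- k).
Hypothesis m_definite : forall p,
  (forall k, (k < size p)%N -> moment m k%:Z p = 0) -> p = 0.
Hypothesis size_Phi : forall n, size (Phi n) = n.+1.
Hypothesis monic_Phi : forall n, Phi n \is monic.
Hypothesis Phi_ortho : forall n l, n != l ->
  \sum_(k < l.+1) ((Phi l)`_k)^*%C * moment m k%:Z (Phi n) = 0.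

Local Notation alpha := (verblunsky Phi).
Local Notation ell := (ell Phi).
Local Notation mom := (moment m).
Local Notation rPhi n := (reversed n (Phi n)).

(** The vanishing constant term stands in for orthogonality to $1$: writing $p=zq$ shifts the
    moments by one, and [m_definite] applies to $q$. *)
Lemma moment_definite0 n p : (size p <= n.+1)%N -> p`_0 = 0 ->
  (forall k, (0 < k <= n)%N -> mom k%:Z p = 0) -> p = 0.
Proof.
move=> pn p0 Hp; have /divpK pE : 'X %| p.
  by rewrite -['X]subr0 -polyC0 dvdp_XsubCl /root horner_coef0 p0.
rewrite -pE in pn Hp *; move: (p %/ 'X) pn Hp {p0 pE} => q pn Hp.
have [->|q0] := eqVneq q 0; first by rewrite mul0r.
rewrite (_ : q = 0) ?mul0r//; apply: m_definite => k kq.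
rewrite size_mulX// ltnS in pn; have kn := leq_trans kq pn.
rewrite -(Hp k.+1) 1?mulrC ?momentXM//; first by congr (moment _ _ _); lia.
Qed.

Lemma coef_Phi_lead n : (Phi n)`_n = 1.
Proof. by have /eqP := monic_Phi n; rewrite lead_coefE size_Phi. Qed.

Lemma coef_Phi_gt n k : (n < k)%N -> (Phi n)`_k = 0.
Proof. by move=> nk; rewrite nth_default// size_Phi. Qed.

Lemma coef_Phi0 n : (Phi n.+1)`_0 = - (alpha n)^*%C.
Proof. by rewrite /verblunsky rmorphN /= conjcK opprK horner_coef0. Qed.

Lemma coef_Phi0_pred n : (0 < n)%N -> (Phi n)`_0 = - (alpha n.-1)^*%C.
Proof. by case: n => // n _; exact: coef_Phi0. Qed.

(** Strong induction on [k]: as [Phi k] is monic, $z^k$ differs from it by lower powers, already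
    known to be orthogonal to [Phi n]. *)
Lemma mom_Phi_lt n k : (k < n)%N -> mom k%:Z (Phi n) = 0.
Proof.
elim/ltn_ind: k => k IH kn.
have := @Phi_ortho n k; rewrite gtn_eqF// => /(_ isT).
rewrite big_ord_recr/= coef_Phi_lead conjc1 mul1r big1 ?add0r// => i _.
by rewrite IH ?mulr0// (ltn_trans _ kn).
Qed.

Lemma mom_Phi_eq0 n (k : int) : 0 <= k -> k < n%:Z -> mom k (Phi n) = 0.
Proof. by case: k => // k _; rewrite ltz_nat; exact: mom_Phi_lt. Qed.

(** This equals $\langle\Phi_n,\Phi_n\rangle$, because the lower powers in the second argument
    contribute nothing. *)
Definition sqnorm n : C := mom n%:Z (Phi n).

(** Restoring the lower powers gives the full double sum for $\langle\Phi_n,\Phi_n\rangle$, which is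
    Hermitian by [m_conj]. *)
Lemma sqnorm_conj n : (sqnorm n)^*%C = sqnorm n.
Proof.
have E : sqnorm n =
    \sum_(k < n.+1) \sum_(i < n.+1)
      (((Phi n)`_k)^*%C * (Phi n)`_i * m (i%:Z - k%:Z)).
  rewrite big_ord_recr/= big1 ?add0r => [|k _].
    rewrite coef_Phi_lead conjc1 /sqnorm (@moment_wide _ _ n.+1) ?size_Phi//.
    by apply: eq_bigr => i _; rewrite mul1r.
  under eq_bigr do rewrite -mulrA.
  rewrite -mulr_sumr -(@moment_wide _ m n.+1 _ k%:Z) ?size_Phi//.
  by rewrite mom_Phi_lt ?mulr0.
rewrite E rmorph_sum/= exchange_big/=; apply: eq_bigr => i _.
rewrite rmorph_sum/=; apply: eq_bigr => k _.
by rewrite !rmorphM/= conjcK m_conj [X in X * _ = _]mulrC; congr (_ * m _); lia.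
Qed.

Lemma mom_rPhi n k : mom k (rPhi n) = (mom (n%:Z - k) (Phi n))^*%C.
Proof. by rewrite moment_reversed ?size_Phi. Qed.

Lemma mom_rPhi_eq0 n (k : int) : 0 < k -> k <= n%:Z -> mom k (rPhi n) = 0.
Proof. by move=> k0 kn; rewrite mom_rPhi mom_Phi_eq0 ?conjc0//; lia. Qed.

Lemma mom_rPhi0 n : mom 0 (rPhi n) = sqnorm n.
Proof. by rewrite mom_rPhi subr0 sqnorm_conj. Qed.

(** In the difference of the two sides the leading terms cancel, the constant term vanishes because
    $\Phi_n^*(0)=1$, and each polynomial involved is orthogonal to $z,\dots,z^n$; [moment_definite0]
    concludes. *)
Lemma szego n : Phi n.+1 = 'X * Phi n - (alpha n)^*%C *: rPhi n.
Proof.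
apply/esym/eqP; rewrite -subr_eq0; apply/eqP.
apply: (@moment_definite0 n) => [||k kn].
- apply/leq_sizeP => j nj; rewrite !coefB coefZ coefXM coef_reversed.
  rewrite leqNgt nj mulr0 subr0 gtn_eqF ?(leq_ltn_trans _ nj)//.
  case: j nj => // j; rewrite ltnS leq_eqVlt => /predU1P[->|nj].
    by rewrite !coef_Phi_lead subrr.
  by rewrite !coef_Phi_gt ?subrr.
- rewrite !coefB coefZ coefXM coef_reversed subn0 coef_Phi_lead conjc1.
  by rewrite coef_Phi0/= mulr1 sub0r opprK addNr.
- rewrite !momentB momentZ momentXM mom_rPhi_eq0 ?mom_Phi_eq0; try lia.
  by rewrite mulr0 !subr0.
Qed.

(** Coefficient of $z^{n+1}$ in the Szego recurrence for $\Phi_{n+2}$: the top coefficient of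
    $\Phi_{n+1}^*$ is $\overline{\Phi_{n+1}(0)}=-\alpha_n$. *)
Lemma ell_succ n : ell n.+2 n.+1 = ell n.+1 n + (alpha n.+1)^*%C * alpha n.
Proof.
rewrite /Defs.ell szego coefB coefZ coefXM/= coef_reversed leqnn subnn.
(* Unless generalised, [alpha n] would be unfolded by [rmorphN], its definition
   being a conjugate. *)
rewrite coef_Phi0; move: (alpha n) (alpha n.+1) => a b.
by rewrite rmorphN/= conjcK; ring.
Qed.

(** Szego recurrence paired with $1$, to which $\Phi_{n+1}$ is orthogonal. *)
Lemma mom_PhiN1 n : mom (- 1) (Phi n) = (alpha n)^*%C * sqnorm n.
Proof.
have := congr1 (mom 0) (szego n).
rewrite momentB momentZ momentXM mom_rPhi0 mom_Phi_eq0; try lia.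
by rewrite sub0r => /esym/eqP; rewrite subr_eq0 => /eqP.
Qed.

(** In $\langle\Phi_n,\Phi_{n+1}\rangle=0$ only the two highest powers of the second argument
    survive. *)
Lemma mom_Phi_succ n : mom n.+1%:Z (Phi n) = - (ell n.+1 n)^*%C * sqnorm n.
Proof.
have := @Phi_ortho n n.+1; rewrite ltn_eqF// => /(_ isT).
rewrite !big_ord_recr/= coef_Phi_lead conjc1 mul1r big1 ?add0r; last first.
  by move=> i _; rewrite mom_Phi_lt ?mulr0.
by move=> /eqP; rewrite addrC addr_eq0 => /eqP ->; rewrite mulNr.
Qed.

(** Szego recurrence paired with $z^{n+1}$; the reversed polynomial contributes the conjugate of
    [mom (- 1) (Phi n)]. *)
Lemma sqnorm_succ n : sqnorm n.+1 = (1 - `|alpha n| ^+ 2) * sqnorm n.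
Proof.
rewrite {1}/sqnorm szego momentB momentZ momentXM mom_rPhi.
rewrite (_ : n.+1%:Z - 1 = n%:Z); last by lia.
rewrite (_ : n%:Z - n.+1%:Z = - 1); last by lia.
rewrite mom_PhiN1; move: (alpha n) => a.
by rewrite rmorphM/= conjcK sqnorm_conj sqr_normc /sqnorm; ring.
Qed.

(** Szego recurrence paired with $z^{-1}$. The index $-2=1-3$ occurs when the cubic term of [A]
    meets the pairing with $z$. *)
Lemma mom_PhiN2 n : mom (- 2) (Phi n) =
  ((alpha n.+1)^*%C * (1 - `|alpha n| ^+ 2) - (alpha n)^*%C * ell n.+1 n)
    * sqnorm n.
Proof.
have := congr1 (mom (- 1)) (szego n).
rewrite momentB momentZ momentXM mom_PhiN1 sqnorm_succ mom_rPhi.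
rewrite (_ : n%:Z - - 1 = n.+1%:Z); last by lia.
rewrite (_ : - 1 - 1 = - 2 :> int)// mom_Phi_succ.
move: (alpha n) (alpha n.+1) => a b; rewrite rmorphM rmorphN/= conjcK => /eqP.
rewrite sqnorm_conj eq_sym subr_eq => /eqP ->; ring.
Qed.

(** * Structure relations from the Pearson recurrence of the moments *)

Variables A B : {poly C}.
Hypothesis size_A : (size A <= 4)%N.
Hypothesis m_pearson : forall k : int,
  \sum_(j < 4) ('i%C * k%:~R * A`_j + B`_j) * m (k + j%:Z) = 0.

Lemma mulA_sum q : A * q = \sum_(j < 4) A`_j *: ('X^j * q).
Proof.
rewrite -{1}(coefK A) (poly_def (size A)).
rewrite (big_ord_widen _ (fun j => A`_j *: 'X^j) size_A).
rewrite big_mkcond mulr_suml; apply: eq_bigr => j _.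
case: ltnP => [_|/(nth_default 0) ->]; first by rewrite scalerAl.
by rewrite mul0r scale0r.
Qed.

Lemma mom_mulA_derive p k : mom k (A * ('X * p^`())) =
  \sum_(j < 4) (k%:~R * A`_j + 'i%C * B`_j) * mom (k - j%:Z) p.
Proof.
pose q := 'X * p^`().
have sq : (size q <= size p)%N.
  by apply/leq_sizeP => j /(nth_default 0) pj; rewrite coefX_deriv pj mulr0.
rewrite mulA_sum (raddf_sum (mom k)) /=; apply/eqP; rewrite -subr_eq0.
rewrite -sumrB (eq_bigr (fun j : 'I_4 => \sum_(l < size p) - 'i%C * p`_l *
  (('i%C * (l%:Z - k)%:~R * A`_j + B`_j) * m (l%:Z - k + j%:Z)))); last first.
  move=> j _; rewrite momentZ momentXnM (moment_wide _ _ sq).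
  rewrite {1}/moment !mulr_sumr -sumrB; apply: eq_bigr => l _.
  rewrite coefX_deriv (_ : l%:Z - (k - j%:Z) = l%:Z - k + j%:Z); last by lia.
  have i2 : 'i%C * 'i%C = -1 :> C by rewrite -expr2 sqr_i.
  by rewrite intrB -[l%:Z%:~R]/(l%:R : C); ring: i2.
rewrite exchange_big big1//= => l _.
by rewrite -mulr_sumr m_pearson mulr0.
Qed.

(* The coefficients are those read off from the functionals that characterise
   the zero polynomial in [moment_definite0]: [z^{n+3}] and [z^{n+2}] give [u3]
   and [u2], the inner products with [z^n], [z^{n+1}], [z^2], [z] give [u0],
   [u1], [v2], [v1], and the value at [0] gives [v0]. *)
Lemma structure_relation n u0 u1 u2 u3 v0 v1 v2 : (3 <= n)%N ->
  u3 = n%:R * A`_3 ->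
  u2 = n%:R * A`_2 - A`_3 * ell n n.-1
    + ('i%C * B`_3 + (2 - n%:R) * A`_3) * (alpha n)^*%C * alpha n.-1 ->
  u1 = 'i%C * B`_1 + (n%:R + 1) * A`_1 - A`_0 * (ell n.+1 n)^*%C
    - ('i%C * B`_0 + n%:R * A`_0) * alpha n * (alpha n.-1)^*%C ->
  u0 = 'i%C * B`_0 + n%:R * A`_0 ->
  v2 = ('i%C * B`_3 + (2 - n%:R) * A`_3) * (alpha n)^*%C ->
  v1 = ('i%C * B`_2 + A`_2 + A`_3 * ell n.+1 n) * (alpha n)^*%C
    + ('i%C * B`_3 + (1 - n%:R) * A`_3)
      * (alpha n.+1)^*%C * (1 - `|alpha n| ^+ 2)
    - u2 * (alpha n)^*%C ->
  v0 = u0 * (alpha n.-1)^*%C ->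
  A * ('X * (Phi n)^`()) =
    (u3 *: 'X^3 + u2 *: 'X^2 + u1 *: 'X^1 + u0 *: 'X^0) * Phi n +
    (v2 *: 'X^2 + v1 *: 'X^1 + v0 *: 'X^0) * rPhi n.
Proof.
move=> n3 u3E u2E u1E u0E v2E v1E v0E.
have n0 : (0 < n)%N by exact: leq_trans n3.
have Phi0 := coef_Phi0_pred n0.
have Phi0c : ((Phi n)`_0)^*%C = - alpha n.-1.
  by rewrite Phi0; move: (alpha _) => a; rewrite rmorphN/= conjcK.
have n1 : n.-1%:R = n%:R - 1 :> C by rewrite -subn1 natrB.
pose q := 'X * (Phi n)^`().
pose U := u3 *: 'X^3 + u2 *: 'X^2 + u1 *: 'X^1 + u0 *: 'X^0.
pose V := v2 *: 'X^2 + v1 *: 'X^1 + v0 *: 'X^0.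
have coefE j : (A * q - (U * Phi n + V * rPhi n))`_j =
  A`_0 * ('X^0 * q)`_j + A`_1 * ('X^1 * q)`_j + A`_2 * ('X^2 * q)`_j
  + A`_3 * ('X^3 * q)`_j
  - (u3 * ('X^3 * Phi n)`_j + u2 * ('X^2 * Phi n)`_j + u1 * ('X^1 * Phi n)`_j
     + u0 * ('X^0 * Phi n)`_j + v2 * ('X^2 * rPhi n)`_j
     + v1 * ('X^1 * rPhi n)`_j + v0 * ('X^0 * rPhi n)`_j).
  rewrite /U /V mulA_sum !big_ord_recr big_ord0 /= add0r.
  by rewrite !mulrDl -!scalerAl !(coefB, coefD, coefZ) !addrA.
apply/eqP; rewrite -subr_eq0; apply/eqP; apply: (@moment_definite0 n.+1).
(* The degree must be at most $n+1$: the coefficients of $z^{n+2}$ and $z^{n+3}$ cancel by the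
   choice of [u2], [v2] and [u3], and beyond them every term is zero. *)
- apply/leq_sizeP => j nj; rewrite coefE !coefXnM !coefX_deriv.
  have [F0 F1 F2 F3] : [/\ (j < 0)%N = false, (j < 1)%N = false,
    (j < 2)%N = false & (j < 3)%N = false] by split; lia.
  rewrite F0 F1 F2 F3 !coef_reversed.
  have [-> -> G] : [/\ (j - 0 <= n)%N = false, (j - 1 <= n)%N = false
    & j = n.+2 \/ (n.+3 <= j)%N] by split; lia.
  rewrite (@coef_Phi_gt n (j - 0)); last by lia.
  rewrite (@coef_Phi_gt n (j - 1)); last by lia.
  case: G => [jE|jn].
    rewrite jE (_ : n.+2 - 2 = n)%N; last by lia.
    rewrite (_ : n.+2 - 3 = n.-1)%N; last by lia.
    rewrite leqnn subnn coef_Phi_lead Phi0c n1 u3E u2E v2E /Defs.ell.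
    by ring.
  rewrite (@coef_Phi_gt n (j - 2)); last by lia.
  rewrite (_ : (j - 2 <= n)%N = false); last by lia.
  move: jn; rewrite leq_eqVlt => /predU1P[<-|jn].
    by rewrite (_ : n.+3 - 3 = n)%N ?coef_Phi_lead ?u3E; [ring|lia].
  by rewrite (@coef_Phi_gt n (j - 3)); [ring|lia].
- rewrite coefE !coefXnM !coefX_deriv !coef_reversed !sub0n subn0 leq0n /=.
  by rewrite coef_Phi_lead conjc1 v0E Phi0; ring.
move=> k kn.
have momE : mom k%:Z (A * q - (U * Phi n + V * rPhi n)) =
  (k%:R * A`_0 + 'i%C * B`_0 - u0) * mom (k%:Z - 0%:Z) (Phi n)
  + (k%:R * A`_1 + 'i%C * B`_1 - u1) * mom (k%:Z - 1%:Z) (Phi n)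
  + (k%:R * A`_2 + 'i%C * B`_2 - u2) * mom (k%:Z - 2%:Z) (Phi n)
  + (k%:R * A`_3 + 'i%C * B`_3 - u3) * mom (k%:Z - 3%:Z) (Phi n)
  - v0 * mom (k%:Z - 0%:Z) (rPhi n) - v1 * mom (k%:Z - 1%:Z) (rPhi n)
  - v2 * mom (k%:Z - 2%:Z) (rPhi n).
  rewrite momentB mom_mulA_derive !big_ord_recr big_ord0 /= add0r.
  rewrite -[k%:Z%:~R]/(k%:R : C) /U /V !mulrDl -!scalerAl.
  rewrite !(momentD, momentZ, momentXnM).
  by ring.
rewrite {}momE.
(* For [3 <= k < n] every moment vanishes. The bound [3 <= n] keeps the low cases [k = 1] and
   [k = 2], where negative indices enter, apart from the high cases [k = n] and [k = n.+1]. *)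
have [kE|[kE|[kE|[kE|kE]]]] :
  k = 1%N \/ k = 2%N \/ (3 <= k < n)%N \/ k = n \/ k = n.+1 by lia.
- rewrite kE (mom_PhiN2 n : mom (1%:Z - 3%:Z) _ = _).
  rewrite (mom_PhiN1 n : mom (1%:Z - 2%:Z) _ = _).
  rewrite (mom_rPhi0 n : mom (1%:Z - 1%:Z) _ = _).
  rewrite (@mom_Phi_eq0 n (1%:Z - 0%:Z)); [|lia|lia].
  rewrite (@mom_Phi_eq0 n (1%:Z - 1%:Z)); [|lia|lia].
  rewrite (@mom_rPhi_eq0 n (1%:Z - 0%:Z)); [|lia|lia].
  rewrite mom_rPhi (_ : n%:Z - (1%:Z - 2%:Z) = n.+1%:Z); last by lia.
  rewrite mom_Phi_succ u3E v1E v2E sqr_normc.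
  move: (ell n.+1 n) (alpha n) (alpha n.+1) => l a b.
  by rewrite rmorphM rmorphN /= conjcK sqnorm_conj; ring.
- rewrite kE (mom_PhiN1 n : mom (2%:Z - 3%:Z) _ = _).
  rewrite (mom_rPhi0 n : mom (2%:Z - 2%:Z) _ = _).
  rewrite (@mom_Phi_eq0 n (2%:Z - 0%:Z)); [|lia|lia].
  rewrite (@mom_Phi_eq0 n (2%:Z - 1%:Z)); [|lia|lia].
  rewrite (@mom_Phi_eq0 n (2%:Z - 2%:Z)); [|lia|lia].
  rewrite (@mom_rPhi_eq0 n (2%:Z - 0%:Z)); [|lia|lia].
  rewrite (@mom_rPhi_eq0 n (2%:Z - 1%:Z)); [|lia|lia].
  by rewrite u3E v2E; ring.
- rewrite (@mom_Phi_eq0 n (k%:Z - 0%:Z)); [|lia|lia].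
  rewrite (@mom_Phi_eq0 n (k%:Z - 1%:Z)); [|lia|lia].
  rewrite (@mom_Phi_eq0 n (k%:Z - 2%:Z)); [|lia|lia].
  rewrite (@mom_Phi_eq0 n (k%:Z - 3%:Z)); [|lia|lia].
  rewrite (@mom_rPhi_eq0 n (k%:Z - 0%:Z)); [|lia|lia].
  rewrite (@mom_rPhi_eq0 n (k%:Z - 1%:Z)); [|lia|lia].
  rewrite (@mom_rPhi_eq0 n (k%:Z - 2%:Z)); [|lia|lia].
  by ring.
- rewrite kE (@mom_Phi_eq0 n (n%:Z - 1%:Z)); [|lia|lia].
  rewrite (@mom_Phi_eq0 n (n%:Z - 2%:Z)); [|lia|lia].
  rewrite (@mom_Phi_eq0 n (n%:Z - 3%:Z)); [|lia|lia].
  rewrite (@mom_rPhi_eq0 n (n%:Z - 0%:Z)); [|lia|lia].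
  rewrite (@mom_rPhi_eq0 n (n%:Z - 1%:Z)); [|lia|lia].
  rewrite (@mom_rPhi_eq0 n (n%:Z - 2%:Z)); [|lia|lia].
  by rewrite u0E; ring.
rewrite kE (@mom_Phi_eq0 n (n.+1%:Z - 2%:Z)); [|lia|lia].
rewrite (@mom_Phi_eq0 n (n.+1%:Z - 3%:Z)); [|lia|lia].
rewrite (@mom_rPhi_eq0 n (n.+1%:Z - 1%:Z)); [|lia|lia].
rewrite (@mom_rPhi_eq0 n (n.+1%:Z - 2%:Z)); [|lia|lia].
rewrite subr0 mom_rPhi (_ : n%:Z - n.+1%:Z = - 1); last by lia.
rewrite mom_PhiN1 mom_Phi_succ (_ : n.+1%:Z - 1%:Z = n%:Z); last by lia.
rewrite -/(sqnorm n) v0E u1E u0E -natr1.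
move: (ell n.+1 n) (alpha n) (alpha n.-1) => l a b.
by rewrite rmorphM /= conjcK sqnorm_conj; ring.
Qed.

Lemma ell_pred n : (0 < n)%N ->
  ell n.+1 n = ell n n.-1 + (alpha n)^*%C * alpha n.-1.
Proof. by case: n => // n _; exact: ell_succ. Qed.

(** The stated coefficients agree with those of [structure_relation] once [ell_succ] and [ell_pred]
    relate the subleading coefficients of consecutive polynomials. *)
Lemma structure_relation_Phi n z : (3 <= n)%N ->
  z * A.[z] * ((Phi n)^`()).[z] =
    Ufun A B Phi n z * (Phi n).[z] + Vfun A B Phi n z * (rPhi n).[z].
Proof.
move=> n3; have n0 : (0 < n)%N by exact: leq_trans n3.
have u2E : coef_s' A B Phi n + n%:R * A`_3 * (alpha n.+1)^*%C * alpha n =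
    n%:R * A`_2 - A`_3 * ell n n.-1
    + ('i%C * B`_3 + (2 - n%:R) * A`_3) * (alpha n)^*%C * alpha n.-1.
  by rewrite /coef_s' ell_succ ell_pred//; ring.
have u1E : coef_s A B Phi n =
    'i%C * B`_1 + (n%:R + 1) * A`_1 - A`_0 * (ell n.+1 n)^*%C
    - ('i%C * B`_0 + n%:R * A`_0) * alpha n * (alpha n.-1)^*%C.
  rewrite /coef_s ell_pred// -natr1.
  move: (alpha n) (alpha n.-1) (ell n n.-1) => a b l.
  by rewrite rmorphD rmorphM /= conjcK; ring.
have v2E : ('i%C * B`_3 - (n%:R - 2) * A`_3) * (alpha n)^*%C =
    ('i%C * B`_3 + (2 - n%:R) * A`_3) * (alpha n)^*%C by ring.
have v1E : - (coef_s' A B Phi n * (alpha n)^*%C + n%:R * A`_3 * (alpha n.+1)^*%C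
      - coef_t A B Phi n) =
    ('i%C * B`_2 + A`_2 + A`_3 * ell n.+1 n) * (alpha n)^*%C
    + ('i%C * B`_3 + (1 - n%:R) * A`_3)
      * (alpha n.+1)^*%C * (1 - `|alpha n| ^+ 2)
    - (coef_s' A B Phi n + n%:R * A`_3 * (alpha n.+1)^*%C * alpha n)
      * (alpha n)^*%C.
  by rewrite /coef_t sqr_normc; ring.
have := congr1 (horner^~ z)
  (structure_relation n3 erefl u2E u1E erefl v2E v1E erefl).
rewrite !hornerE /= => E.
by rewrite mulrAC mulrC mulrA [LHS]E /Ufun /Vfun; ring.
Qed.

(** For nonzero [z], the first relation is taken at $1/\overline z$, conjugated and multiplied by
    $z^{n+3}$. *)
Lemma structure_relation_rPhi n z : (3 <= n)%N ->
  - Ahat A z * ((rPhi n)^`()).[z] =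
    Wfun A B Phi n z * (Phi n).[z] + Yfun A B Phi n z * (rPhi n).[z].
Proof.
have cD (x t : C) : (x + t)^*%C = x^*%C + t^*%C by exact: rmorphD.
have cN (x : C) : (- x)^*%C = - x^*%C by exact: rmorphN.
have cM (x t : C) : (x * t)^*%C = x^*%C * t^*%C by exact: rmorphM.
have cX (x : C) l : (x ^+ l)^*%C = x^*%C ^+ l by exact: rmorphXn.
have ci : ('i%C)^*%C = - 'i%C :> C.
  by apply/eqP; rewrite eq_complex /= oppr0 !eqxx.
pose conjcE := (cD, cN, cM, cX, ci, @conjcK R, @conjc_nat R, @conjc1 R).
move=> n3; have n0 : (0 < n)%N by exact: leq_trans n3.
(* There is no reflected point for [z = 0]; the identity between constant terms is checked
   directly. *)
have [->|z0] := eqVneq z 0.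
  rewrite !horner_coef0 coef_deriv !coef_reversed n0 subn1 subn0.
  rewrite coef_Phi_lead mulr1n /Ahat /Wfun /Yfun /coef_s' /coef_p.
  rewrite ell_succ ell_pred//.
  rewrite (coef_Phi0_pred n0).
  rewrite -[(Phi n)`_n.-1]/(ell n n.-1).
  move: (alpha n) (alpha n.-1) (alpha n.+1) (ell n n.-1) => a b c l.
  rewrite !conjcE; ring.
set y := (z^*%C)^-1.
have yJ : y^*%C = z^-1 by rewrite /y conjc_inv conjcK.
have AhatE : Ahat A z = z ^+ 3 * (A.[y])^*%C.
  rewrite -horner_reversed// horner_poly !big_ord_recr big_ord0 /= /Ahat.
  by ring.
have rE : (rPhi n).[z] = z ^+ n * ((Phi n).[y])^*%C.
  by rewrite horner_reversed// size_Phi.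
(* Reversal is an involution on polynomials of degree at most $n$. *)
have pE : (Phi n).[z] = z ^+ n * ((rPhi n).[y])^*%C.
  rewrite -horner_reversed ?size_reversed//; congr (_.[z]).
  apply/polyP => k; rewrite !coef_reversed; case: leqP => [kn|nk].
    by rewrite leq_subr subKn// conjcK.
  by rewrite coef_Phi_gt.
have rdE : z * ((rPhi n)^`()).[z] =
    n%:R * (rPhi n).[z] - z ^+ n * (y * ((Phi n)^`()).[y])^*%C.
  have -> : z ^+ n * (y * ((Phi n)^`()).[y])^*%C =
      (reversed n ('X * (Phi n)^`())).[z].
    rewrite horner_reversed// ?hornerE//.
    apply/leq_sizeP => -[|k] // nk; rewrite coefXM/= coef_deriv coef_Phi_gt//.
    by rewrite mul0rn.
  rewrite mulrC -hornerMX -hornerZ -hornerN -hornerD; congr (_.[z]).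
  apply/polyP => k; rewrite coefMX coefB coefZ !coef_reversed.
  rewrite coefX_deriv cM conjc_nat; case: k => [|k] /=.
    by rewrite subn0 subrr.
  rewrite coef_deriv coef_reversed; case: ifPn => [kn|_]; last first.
    by rewrite mulr0 subrr mul0rn.
  by rewrite natrB// mulrBl opprB addrC subrK mulr_natl.
have := congr1 conjc (structure_relation_Phi y n3).
rewrite cD !cM yJ => E.
(* The extra [n%:R * Ahat A z] matches the term $n\Phi_n^*$ of [rdE]. *)
have zU : z ^+ 3 * (Ufun A B Phi n y)^*%C =
    z * Yfun A B Phi n z + n%:R * Ahat A z.
  rewrite /Ufun /Yfun /Ahat.
  move: (coef_s A B Phi n) (coef_s' A B Phi n) => s s'.
  move: (alpha n) (alpha n.+1) => a b.
  by rewrite !conjcE yJ; field.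
have zV : z ^+ 3 * (Vfun A B Phi n y)^*%C = z * Wfun A B Phi n z.
  rewrite /Vfun /Wfun /coef_p.
  move: (coef_t A B Phi n) (coef_s' A B Phi n) => t s'.
  move: (alpha n) (alpha n.+1) (alpha n.-1) => a b c.
  by rewrite !conjcE yJ; field.
apply: (mulfI z0).
rewrite mulrCA rdE mulrBr [in X in _ - X]AhatE mulrDr !(mulrA z).
have -> : z * Yfun A B Phi n z =
  z ^+ 3 * (Ufun A B Phi n y)^*%C - n%:R * Ahat A z by rewrite zU addrK.
rewrite -zV pE cM yJ (_ : - (z ^+ 3 * _) * _ = - (z ^+ 3 * z ^+ n
    * (z^-1 * (A.[y])^*%C * (((Phi n)^`()).[y])^*%C))); last by ring.
by rewrite E rE; ring.
Qed.

End MonicOrthogonal.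

(** * Moments of a weight on the circle *)

Section ComplexIntegral.
Local Open Scope classical_set_scope.
Local Open Scope ring_scope.
Context {R : realType}.
Local Notation C := R[i].
Local Notation mu := (@lebesgue_measure R).
Implicit Types (F G : R -> C) (D : set R).

Lemma ReM (x y : C) : complex.Re (x * y) =
  complex.Re x * complex.Re y - complex.Im x * complex.Im y.
Proof. by case: x y => [a b] [c d]. Qed.

Lemma ImM (x y : C) : complex.Im (x * y) =
  complex.Re x * complex.Im y + complex.Im x * complex.Re y.
Proof. by case: x y => [a b] [c d]. Qed.

Lemma ReD (x y : C) : complex.Re (x + y) = complex.Re x + complex.Re y.
Proof. by case: x y => [a b] [c d]. Qed.

Lemma ImD (x y : C) : complex.Im (x + y) = complex.Im x + complex.Im y.
Proof. by case: x y => [a b] [c d]. Qed.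

Definition cintegrable D F : Prop :=
  mu.-integrable D (EFin \o (fun t => complex.Re (F t))) /\
  mu.-integrable D (EFin \o (fun t => complex.Im (F t))).

Section Linearity.
Variables (D : set (measurableTypeR R)) (mD : measurable D).

Lemma cintegrable0 : cintegrable D (fun=> 0).
Proof. by split; apply: integrable0. Qed.

Lemma cintegral0 : cintegral D (fun=> 0) = 0.
Proof. by rewrite /cintegral /Rintegral integral0. Qed.

Lemma cintegrableD F G : cintegrable D F -> cintegrable D G ->
  cintegrable D (fun t => F t + G t).
Proof.
move=> [F1 F2] [G1 G2]; split.
- rewrite (_ : _ \o _ = (EFin \o (fun t => complex.Re (F t))) \+
    (EFin \o (fun t => complex.Re (G t)))); first exact: integrableD.
  by apply/funext => t /=; rewrite ReD.
- rewrite (_ : _ \o _ = (EFin \o (fun t => complex.Im (F t))) \+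
    (EFin \o (fun t => complex.Im (G t)))); first exact: integrableD.
  by apply/funext => t /=; rewrite ImD.
Qed.

Lemma cintegralD F G : cintegrable D F -> cintegrable D G ->
  cintegral D (fun t => F t + G t) = cintegral D F + cintegral D G.
Proof.
move=> [F1 F2] [G1 G2]; apply/eqP; rewrite eq_complex /= -!RintegralD//.
by apply/andP; split; apply/eqP; apply: eq_Rintegral => t _; rewrite (ReD, ImD).
Qed.

Lemma integrableZ_EFin (a : R) (f : R -> R) : mu.-integrable D (EFin \o f) ->
  mu.-integrable D (EFin \o (fun t => a * f t)).
Proof. by move=> fi; have := integrableZl mD a fi. Qed.

Lemma cintegrableZ c F : cintegrable D F -> cintegrable D (fun t => c * F t).
Proof.
move=> [F1 F2]; split.
- rewrite (_ : _ \o _ =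
    ((EFin \o (fun t => complex.Re c * complex.Re (F t))%R) \-
     (EFin \o (fun t => complex.Im c * complex.Im (F t))%R))%E).
    by apply: integrableB => //; exact: integrableZ_EFin.
  by apply/funext => t /=; rewrite ReM.
- rewrite (_ : _ \o _ = (EFin \o (fun t => complex.Re c * complex.Im (F t))) \+
    (EFin \o (fun t => complex.Im c * complex.Re (F t)))).
    by apply: integrableD => //; exact: integrableZ_EFin.
  by apply/funext => t /=; rewrite ImM.
Qed.

Lemma cintegralZ c F : cintegrable D F ->
  cintegral D (fun t => c * F t) = c * cintegral D F.
Proof.
move=> [F1 F2]; apply/eqP; rewrite eq_complex ReM ImM /=.
rewrite -!RintegralZl// -RintegralB//; [|exact: integrableZ_EFin..].
rewrite -RintegralD//; [|exact: integrableZ_EFin..].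
by apply/andP; split; apply/eqP; apply: eq_Rintegral => t _; rewrite (ReM, ImM).
Qed.

Lemma cintegrable_sum I (s : seq I) (F : I -> R -> C) :
  (forall i, cintegrable D (F i)) ->
  cintegrable D (fun t => \sum_(i <- s) F i t).
Proof.
move=> Fi; elim: s => [|i s IHs].
  by under eq_fun do rewrite big_nil; exact: cintegrable0.
by under eq_fun do rewrite big_cons; exact: cintegrableD.
Qed.

Lemma cintegral_sum I (s : seq I) (F : I -> R -> C) :
  (forall i, cintegrable D (F i)) ->
  cintegral D (fun t => \sum_(i <- s) F i t) = \sum_(i <- s) cintegral D (F i).
Proof.
move=> Fi; elim: s => [|i s IHs].
  rewrite big_nil -[RHS]cintegral0; congr cintegral.
  by apply/funext => t; rewrite big_nil.
rewrite big_cons -IHs -cintegralD//; last exact: cintegrable_sum.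
by congr cintegral; apply/funext => t; rewrite big_cons.
Qed.

Lemma cintegral_conj F : cintegrable D F ->
  cintegral D (fun t => (F t)^*%C) = (cintegral D F)^*%C.
Proof.
move=> [F1 F2]; apply/eqP; rewrite eq_complex /=.
apply/andP; split; apply/eqP; first by apply: eq_Rintegral => t _; case: (F t).
rewrite -[RHS]mulN1r -RintegralZl//; apply: eq_Rintegral => t _.
by rewrite mulN1r; case: (F t).
Qed.

End Linearity.

Lemma is_cderiveM F G t f g : is_cderive F t f -> is_cderive G t g ->
  is_cderive (fun u => F u * G u) t (f * G t + F t * g).
Proof.
move=> [F1 F2] [G1 G2]; split.
- rewrite (_ : (fun _ => _) =
    ((fun u => complex.Re (F u)) * (fun u => complex.Re (G u)))
    - ((fun u => complex.Im (F u)) * (fun u => complex.Im (G u)))); last first.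
    by apply/funext => u; rewrite ReM.
  apply: (is_derive_eq (is_deriveB (is_deriveM F1 G1) (is_deriveM F2 G2))).
  by rewrite ReD !ReM /GRing.scale /=; ring.
- rewrite (_ : (fun _ => _) =
    ((fun u => complex.Re (F u)) * (fun u => complex.Im (G u)))
    + ((fun u => complex.Im (F u)) * (fun u => complex.Re (G u)))); last first.
    by apply/funext => u; rewrite ImM.
  apply: (is_derive_eq (is_deriveD (is_deriveM F1 G2) (is_deriveM F2 G1))).
  by rewrite ImD !ImM /GRing.scale /=; ring.
Qed.

(** Multiplication by $i$ preserves the modulus and turns the imaginary part into minus the real
    part. *)
Lemma normc_ge_Im (x : C) : (`|complex.Im x|%:C)%C <= `|x|.
Proof.
have i1 : `|'i%C : C| = 1.
  by rewrite normc_def /= expr0n add0r expr1n sqrtr1.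
have := normc_ge_Re (x * 'i%C).
by rewrite ReiNIm normrN normrM i1 mulr1.
Qed.

Lemma abs_continuous_Re a b F : cabs_continuous a b F ->
  abs_continuous a b (fun t => complex.Re (F t)).
Proof.
move=> acF e /acF[d d0 Fd]; exists d => // k s t st tst /(Fd _ _ _ st tst) H.
rewrite -ltcR; apply: le_lt_trans H; rewrite rmorph_sum /=.
apply: ler_sum => i _; apply: le_trans (normc_ge_Re _).
by rewrite -[F (t i) - _]/(F (t i) + - F (s i)) ReD; case: (F (s i)).
Qed.

Lemma abs_continuous_Im a b F : cabs_continuous a b F ->
  abs_continuous a b (fun t => complex.Im (F t)).
Proof.
move=> acF e /acF[d d0 Fd]; exists d => // k s t st tst /(Fd _ _ _ st tst) H.
rewrite -ltcR; apply: le_lt_trans H; rewrite rmorph_sum /=.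
apply: ler_sum => i _; apply: le_trans (normc_ge_Im _).
by rewrite -[F (t i) - _]/(F (t i) + - F (s i)) ImD; case: (F (s i)).
Qed.

(** Absolute continuity is asked of each component, the form in which it is obtained for products
    with [expik k]. *)
Lemma cintegral_FTC a b F f : a <= b ->
  abs_continuous a b (fun t => complex.Re (F t)) ->
  abs_continuous a b (fun t => complex.Im (F t)) ->
  cintegrable `[a, b] f ->
  {ae mu, forall t, t \in `[a, b] -> is_cderive F t (f t)} ->
  cintegral `[a, b] f = F b - F a.
Proof.
move=> ab ReF ImF [Ref Imf] Ff.
have aeF : Filter (nbhs (almost_everywhere mu)) := ae_filter_ringOfSetsType mu.
rewrite /cintegral (abs_continuous_FTC ab ReF Ref); last first.
  by apply: filterS Ff => t /[apply] -[].
rewrite (abs_continuous_FTC ab ImF Imf); last first.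
  by apply: filterS Ff => t /[apply] -[].
by case: (F a) (F b) => [? ?] [? ?].
Qed.

End ComplexIntegral.

(** * Complex exponentials of integer frequency *)

Section Trigonometric.
Local Open Scope ring_scope.
Context {R : realType}.
Local Notation C := R[i].

Definition expik (k : int) (t : R) : C := expi (k%:~R * t).

Lemma expiD (s t : R) : expi (s + t) = expi s * expi t.
Proof.
by apply/eqP; rewrite eq_complex ReM ImM /= cosD sinD eqxx addrC eqxx.
Qed.

Lemma expi0 : expi (0 : R) = 1.
Proof. by rewrite /expi cos0 sin0. Qed.

Lemma expi_conj (t : R) : (expi t)^*%C = expi (- t).
Proof. by rewrite /expi /= cosN sinN. Qed.

Lemma expi2pi : expi (2 * pi) = 1 :> C.
Proof. by rewrite /expi mulr_natl cos2pi sin2pi. Qed.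

Lemma expikD k l t : expik (k + l) t = expik k t * expik l t.
Proof. by rewrite /expik intrD mulrDl expiD. Qed.

Lemma expik_conj k t : (expik k t)^*%C = expik (- k) t.
Proof. by rewrite /expik expi_conj intrN mulNr. Qed.

Lemma expik_nat n t : expik n%:Z t = expi t ^+ n.
Proof.
elim: n => [|n IHn]; first by rewrite /expik mul0r expi0.
have e1 : expi t = expik 1 t by rewrite /expik mul1r.
by rewrite exprS -IHn e1 -expikD intS.
Qed.

Lemma expik0 k : expik k 0 = 1.
Proof. by rewrite /expik mulr0 expi0. Qed.

Lemma expik2pi k : expik k (2 * pi) = 1.
Proof.
have H n : expik n%:Z (2 * pi) = 1 by rewrite expik_nat expi2pi expr1n.
by case: k => n; [exact: H|rewrite NegzE -expik_conj H conjc1].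
Qed.

Lemma horner_expi (p : {poly C}) t :
  p.[expi t] = \sum_(i < size p) p`_i * expik i%:Z t.
Proof. by rewrite horner_coef; apply: eq_bigr => i _; rewrite expik_nat. Qed.

Lemma is_derive_linear (c t : R) : is_derive t (1 : R) ( *%R c) c.
Proof.
have -> : *%R c = c \*: (id : R -> R) by apply/funext.
by apply: is_derive_eq; rewrite /GRing.scale /= mulr1.
Qed.

Lemma is_derive_cosM (c t : R) :
  is_derive t (1 : R) (fun u => cos (c * u)) (- (c * sin (c * t))).
Proof.
have H := is_derive1_comp (is_derive_cos (c * t)) (is_derive_linear c t).
apply: (is_derive_eq H).
by rewrite mulNr mulrC.
Qed.

Lemma is_derive_sinM (c t : R) :
  is_derive t (1 : R) (fun u => sin (c * u)) (c * cos (c * t)).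
Proof.
have H := is_derive1_comp (is_derive_sin (c * t)) (is_derive_linear c t).
apply: (is_derive_eq H).
by rewrite mulrC.
Qed.

Lemma is_cderive_expik k t : is_cderive (expik k) t ('i%C * k%:~R * expik k t).
Proof.
have kC : k%:~R = (k%:~R : R)%:C%C :> C by rewrite rmorph_int.
split; rewrite /expik /expi kC /=.
- by apply: (is_derive_eq (is_derive_cosM _ _)); ring.
- by apply: (is_derive_eq (is_derive_sinM _ _)); ring.
Qed.

Lemma abs_continuous_cosM (a b c : R) :
  abs_continuous a b (fun t => cos (c * t)).
Proof.
apply: (@abs_continuous_lipschitz _ _ _ _ `|c|).
apply: (@lipschitz_derive _ _ (fun t => - (c * sin (c * t)))) => [t|].
  exact: is_derive_cosM.
by move=> t; rewrite normrN normrM ler_piMr// sin_max.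
Qed.

Lemma abs_continuous_sinM (a b c : R) :
  abs_continuous a b (fun t => sin (c * t)).
Proof.
apply: (@abs_continuous_lipschitz _ _ _ _ `|c|).
apply: (@lipschitz_derive _ _ (fun t => c * cos (c * t))) => [t|].
  exact: is_derive_sinM.
by move=> t; rewrite normrM ler_piMr// cos_max.
Qed.

End Trigonometric.

(** * Trigonometric moments of the weight: integrability, definiteness, Pearson recurrence *)

Section WeightMoments.
Local Open Scope classical_set_scope.
Local Open Scope ring_scope.
Context {R : realType}.
Local Notation C := R[i].
Local Notation mu := (@lebesgue_measure R).
Local Notation D := (`[0, 2 * pi]%classic : set R).
Variable w : R -> R.
Hypothesis w_weight : positive_weight w.

Definition weight_moment (k : int) : C :=
  cintegral D (fun t => expik k t * ((w t)%:C)%C).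

(** Cosine and sine are bounded and continuous, so their products with the integrable [w] are
    integrable. *)
Lemma cintegrable_expik_weight k :
  cintegrable D (fun t => expik k t * ((w t)%:C)%C).
Proof.
have bnd (h : R -> R) : continuous h -> (forall t, `|h t| <= 1) ->
    mu.-integrable D (EFin \o (fun t => h t * w t)).
  move=> ch h1; rewrite (_ : _ \o _ = ((EFin \o h) \* (EFin \o w))%E)//.
  apply: integrableMr => //; last by case: w_weight.
  - apply: measurable_funTS; exact: continuous_measurable_fun.
  - exists 1; split; first exact: num_real.
    by move=> x x1 t _; exact: le_trans (h1 t) (ltW x1).
have clin (c : R) : continuous ( *%R c) by exact: mulrl_continuous.
split.
- rewrite (_ : (fun t => _) = (fun t => cos (k%:~R * t) * w t)).
    apply: bnd => t; last exact: cos_max.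
    by apply: continuous_comp; [exact: clin|exact: continuous_cos].
  by apply/funext => t; rewrite ReM /= mulr0 subr0.
- rewrite (_ : (fun t => _) = (fun t => sin (k%:~R * t) * w t)).
    apply: bnd => t; last exact: sin_max.
    by apply: continuous_comp; [exact: clin|exact: continuous_sin].
  by apply/funext => t; rewrite ImM /= mulr0 add0r.
Qed.

Lemma weight_moment_conj k : (weight_moment k)^*%C = weight_moment (- k).
Proof.
rewrite /weight_moment -cintegral_conj//; last exact: cintegrable_expik_weight.
congr cintegral; apply/funext => t.
by rewrite -expik_conj -[in RHS](conjc_real (w t)) -rmorphM.
Qed.

Lemma inner_integrandE (p q : {poly C}) :
  (fun t => p.[expi t] * (q.[expi t])^*%C * ((w t)%:C)%C) =
  (fun t => \sum_(k < size q) \sum_(i < size p)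
    (q`_k)^*%C * p`_i * (expik (i%:Z - k%:Z) t * ((w t)%:C)%C)).
Proof.
apply/funext => t.
have -> : (q.[expi t])^*%C = \sum_(k < size q) (q`_k)^*%C * expik (- k%:Z) t.
  rewrite horner_expi [LHS]rmorph_sum; apply: eq_bigr => k _.
  by rewrite -expik_conj [LHS]rmorphM.
rewrite horner_expi [X in X * _]mulrC mulr_suml mulr_suml.
apply: eq_bigr => k _; rewrite mulr_sumr mulr_suml; apply: eq_bigr => i _.
by rewrite expikD; ring.
Qed.

Lemma cintegrable_inner (p q : {poly C}) :
  cintegrable D (fun t => p.[expi t] * (q.[expi t])^*%C * ((w t)%:C)%C).
Proof.
rewrite inner_integrandE.
apply: cintegrable_sum => // k; apply: cintegrable_sum => // i.
exact/cintegrableZ/cintegrable_expik_weight.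
Qed.

(** Termwise integration; this carries orthogonality over to the form of [Phi_ortho]. *)
Lemma inner_moment (p q : {poly C}) : inner w (horner p) (horner q) =
  \sum_(k < size q) (q`_k)^*%C * moment weight_moment k%:Z p.
Proof.
have ip k i := cintegrableZ (measurable_itv _)
  ((q`_k)^*%C * p`_i) (cintegrable_expik_weight (i%:Z - k%:Z)).
rewrite /inner inner_integrandE.
rewrite cintegral_sum//; last first.
  by move=> k; apply: cintegrable_sum => // i; exact: ip.
apply: eq_bigr => k _; rewrite cintegral_sum//.
rewrite mulr_sumr; apply: eq_bigr => i _.
by rewrite cintegralZ// ?mulrA//; exact: cintegrable_expik_weight.
Qed.

Lemma integral_weight_eq0 (N : R -> R) : (forall t, 0 <= N t) ->
  mu.-integrable D (EFin \o (fun t => N t * w t)) ->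
  (\int[mu]_(t in D) (N t * w t))%R = 0 ->
  {ae mu, forall t, t \in `[0, 2 * pi] -> N t = 0}.
Proof.
move=> N0 iN int0.
have aeF : Filter (nbhs (almost_everywhere mu)) := ae_filter_ringOfSetsType mu.
have [_ w0] := w_weight.
have mN : measurable_fun D (EFin \o (fun t => N t * w t)).
  exact: measurable_int iN.
(* The weight is positive only almost everywhere, so the integrand equals its absolute value only
   almost everywhere. *)
have ae_abs : ae_eq mu D (fun t => `|(N t * w t)%:E|%E)
    (EFin \o (fun t => N t * w t)).
  apply: filterS w0 => t wt Dt /=.
  by rewrite ger0_norm// mulr_ge0// ltW// wt.
have : (\int[mu]_(t in D) `|(N t * w t)%:E| = 0)%E.
  rewrite (ae_eq_integral _ _ _ _ _ ae_abs)//.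
    by rewrite -[LHS]fineK ?int0 ?integrable_fin_num// [fine _]int0.
  exact: measurableT_comp.
move=> /(ae_eq_integral_abs mu (measurable_itv _) mN).
apply: filterS2 w0 => t wt /[swap] tD.
move=> /(_ tD)/= [] /eqP; rewrite mulf_eq0 => /orP[/eqP//|].
by rewrite gt_eqF// wt.
Qed.

(** A nonzero polynomial has finitely many roots, hence finitely many root angles in $[0,\pi]$;
    together with a null set they cannot cover an interval of positive length. *)
Lemma negligible_expi_root (p : {poly C}) : p != 0 ->
  ~ {ae mu, forall t, t \in `[0, 2 * pi] -> p.[expi t] = 0}.
Proof.
move=> p0 aep.
(* On the upper half circle [acos] recovers the angle from the real part, so [S] is finite. *)
pose S : set R := [set t | 0 <= t <= pi /\ p.[expi t] = 0].
have finS : finite_set S.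
  apply: (@sub_finite_set _ _ ((fun z : C => acos (complex.Re z)) @`
    [set z | root p z])).
    move=> t [tpi pt]; exists (expi t); first exact/rootP.
    by rewrite /= cosK// in_itv.
  apply: finite_image.
  have [rs prs] := closed_field_poly_normal p.
  apply: (@sub_finite_set _ _ [set` rs]); last exact: finite_seq.
  by move=> z /=; rewrite prs rootZ ?lead_coef_eq0// root_prod_XsubC.
have S0 : mu S = 0.
  by apply: countable_lebesgue_measure0; exact: finite_set_countable.
have piR : (0 : R) < pi by exact: pi_gt0.
have : mu `[0, pi] = 0.
  apply: measure_negligible; first exact: measurable_itv.
  apply: (@negligibleS _ _ _ mu (_ `|` S)); last first.
    apply: negligibleU aep _; exists S; split => //.
    apply: countable_measurable; last exact: finite_set_countable.
    exact: measurable_set1.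
  move=> t /=; rewrite in_itv/= => tpi.
  have [pt|pt] := eqVneq p.[expi t] 0; [by right|left => /= H].
  move/eqP: pt; apply; apply: H; rewrite in_itv/=.
  case/andP: tpi => -> tpi /=; apply: le_trans tpi _.
  by rewrite ler_peMl// ?ler1n// ltW.
by rewrite lebesgue_measure_itv/= lte_fin piR sube0 => -[] /eqP; rewrite gt_eqF.
Qed.

(** Expanding the second argument of $\langle p,p\rangle$ gives zero, so $|p|^2w$ has zero integral
    and [p] vanishes at almost every point of the circle. *)
Lemma weight_moment_definite (p : {poly C}) :
  (forall k, (k < size p)%N -> moment weight_moment k%:Z p = 0) -> p = 0.
Proof.
move=> p_orth; apply: contrapT => /eqP p0; apply: (negligible_expi_root p0).
have aeF : Filter (nbhs (almost_everywhere mu)) := ae_filter_ringOfSetsType mu.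
pose N t := complex.Re (p.[expi t]) ^+ 2 + complex.Im (p.[expi t]) ^+ 2.
have NE : (fun t => complex.Re (p.[expi t] * (p.[expi t])^*%C * ((w t)%:C)%C)) =
    (fun t => N t * w t).
  by apply/funext => t; rewrite /N !ReM /=; case: (p.[expi t]) => a b /=; ring.
have N0 t : 0 <= N t by rewrite addr_ge0// sqr_ge0.
have [iN _] := cintegrable_inner p p; rewrite NE in iN.
have int0 : (\int[mu]_(t in D) (N t * w t))%R = 0.
  have : complex.Re (inner w (horner p) (horner p)) = 0.
    by rewrite inner_moment big1// => k _; rewrite p_orth ?mulr0.
  by rewrite /= NE.
apply: filterS (integral_weight_eq0 N0 iN int0) => t /[apply] /eqP.
rewrite paddr_eq0 ?sqr_ge0// !sqrf_eq0 => /andP[/eqP Re0 /eqP Im0].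
by apply/eqP; rewrite eq_complex Re0 Im0 !eqxx.
Qed.

(** The sum is the integral over a period of the derivative of $e^{ikt}A(e^{it})w(t)$. *)
Lemma weight_moment_pearson (A B : {poly C}) : (size A <= 4)%N ->
  (size B <= 4)%N -> pearson A B w ->
  A.[1] * ((w (2 * pi) - w 0)%:C)%C = 0 ->
  forall k : int,
    \sum_(j < 4) ('i%C * k%:~R * A`_j + B`_j) * weight_moment (k + j%:Z) = 0.
Proof.
move=> sA sB [acF dF] bnd k.
have aeF : Filter (nbhs (almost_everywhere mu)) := ae_filter_ringOfSetsType mu.
have pi20 : 0 <= 2 * pi :> R by rewrite mulr_ge0// pi_ge0.
set F := (fun t : R => A.[expi t] * ((w t)%:C)%C) in acF dF.
have ic j := cintegrableZ (measurable_itv _) ('i%C * k%:~R * A`_j + B`_j)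
  (cintegrable_expik_weight (k + j%:Z)).
pose f t := \sum_(j < 4) ('i%C * k%:~R * A`_j + B`_j) *
  (expik (k + j%:Z) t * ((w t)%:C)%C).
have fE t : f t = 'i%C * k%:~R * expik k t * F t +
    expik k t * (B.[expi t] * ((w t)%:C)%C).
  rewrite /f /F !(horner_coef_wide _ sA) !(horner_coef_wide _ sB).
  rewrite !mulr_suml !mulr_sumr -big_split; apply: eq_bigr => j _ /=.
  by rewrite expikD expik_nat; ring.
have -> : \sum_(j < 4) ('i%C * k%:~R * A`_j + B`_j) * weight_moment (k + j%:Z) =
    cintegral D f.
  rewrite [RHS]cintegral_sum//; apply: eq_bigr => j _.
  by rewrite cintegralZ//; exact: cintegrable_expik_weight.
have ReF := abs_continuous_Re acF; have ImF := abs_continuous_Im acF.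
rewrite (@cintegral_FTC _ _ _ (fun t => expik k t * F t) f pi20).
(* All exponentials equal $1$ at both endpoints, so for every [k] the boundary term is the one
   assumed to vanish. *)
- rewrite /F expik2pi expik0 !mul1r expi2pi expi0 -mulrBr -bnd.
  by congr (_ * _); rewrite rmorphB.
- rewrite (_ : (fun t => _) = (fun t => cos (k%:~R * t) * complex.Re (F t))
      \+ (\- (fun t => sin (k%:~R * t) * complex.Im (F t)))).
    apply: abs_continuousD; last apply: abs_continuousN.
      exact: abs_continuousM pi20 (abs_continuous_cosM _ _ _) ReF.
    exact: abs_continuousM pi20 (abs_continuous_sinM _ _ _) ImF.
  by apply/funext => t; rewrite ReM.
- rewrite (_ : (fun t => _) = (fun t => cos (k%:~R * t) * complex.Im (F t))
      \+ (fun t => sin (k%:~R * t) * complex.Re (F t))).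
    apply: abs_continuousD.
      exact: abs_continuousM pi20 (abs_continuous_cosM _ _ _) ImF.
    exact: abs_continuousM pi20 (abs_continuous_sinM _ _ _) ReF.
  by apply/funext => t; rewrite ImM.
- exact: cintegrable_sum.
- apply: filterS dF => t /[apply] dFt; rewrite fE.
  exact: is_cderiveM (is_cderive_expik k t) dFt.
Qed.

End WeightMoments.

Local Open Scope ring_scope.

Theorem theorem3p1 (R : realType) (A B : {poly R[i]}) (w : R -> R)
    (Phi : nat -> {poly R[i]})
    (degA : (size A <= 4)%N) (degB : (size B <= 4)%N)
    (w_weight : positive_weight w)
    (Aw_pearson : pearson A B w)
    (Aw_boundary : A.[1] * ((w (2 * pi) - w 0)%:C)%C = 0)
    (Phi_opuc : monic_orthogonal w Phi)
    (n : nat) (n_ge3 : (3 <= n)%N) (z : R[i]) :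
  z * A.[z] * ((Phi n)^`()).[z] =
    Ufun A B Phi n z * (Phi n).[z] + Vfun A B Phi n z * (reversed n (Phi n)).[z]
  /\
  - Ahat A z * ((reversed n (Phi n))^`()).[z] =
    Wfun A B Phi n z * (Phi n).[z] + Yfun A B Phi n z * (reversed n (Phi n)).[z].
Proof.
have [sPhi mPhi oPhi] := Phi_opuc.
have mJ := weight_moment_conj w_weight.
have mdef := weight_moment_definite w_weight.
have mpear := weight_moment_pearson w_weight degA degB Aw_pearson Aw_boundary.
have mortho k l : k != l ->
    \sum_(j < l.+1) ((Phi l)`_j)^*%C * moment (weight_moment w) j%:Z (Phi k) = 0.
  by move=> /oPhi; rewrite (inner_moment w_weight) sPhi.
split.
- exact: (structure_relation_Phi mJ mdef sPhi mPhi mortho degA mpear).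
- exact: (structure_relation_rPhi mJ mdef sPhi mPhi mortho degA mpear).
Qed.
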